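(* Let $G$ be a digraph rooted at $v$ such that the induced subdigraph $G[V(G)\setminus\{v\}]$ is strongly connected and $G$ has no non-trivial dominators. Then the Kirchhoff polynomial $\kappa(G)$ is prime.
   Context: Digraphs are finite directed graphs without loops; parallel edges are allowed. An arborescence of a digraph $G=(V,E)$ is a subdigraph $A$ spanning all of $V$ with a root vertex from which every vertex is reachable along a unique directed path in $A$ (a rooted directed spanning tree with edges directed away from the root). Arborescences are identified with their edge sets. Let $\mathsf{arb}(G)$ be the set of all arborescences of $G$ (over all roots). Each edge $e\in E$ is regarded as a variable, distinct edges being distinct variables. The Kirchhoff polynomial is $\kappa(G)=\sum_{A\in\mathsf{arb}(G)}\prod_{e\in A}e\in\mathbb{Q}[e : e\in E]$; for a one-vertex digraph $\kappa(G)=1$. A polynomial is called prime if it has only trivial factors, i.e. whenever it equals $P\cdot Q$, one of $P,Q$ is a constant (with this convention the constant $1$ counts as prime). $G$ is rooted at $v$ if $v$ has no incoming edges and every other vertex is reachable from $v$ by a directed path. If $G$ is rooted at $v$, a vertex $u$ dominates a vertex $w$ if all directed paths from $v$ to $w$ go through $u$; $\mathsf{dom}_G(u)$ denotes the set of all vertices dominated by $u$ (so $u\in\mathsf{dom}_G(u)$). A vertex $u$ is a non-trivial dominator if $u\neq v$ and $\mathsf{dom}_G(u)\neq\{u\}$. A digraph is strongly connected if any two of its vertices are reachable from each other by directed paths. *)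

(* Defs.v *)
From HB Require Import structures.
From mathcomp Require Import all_boot all_order all_algebra.
From mathcomp Require Import boolp.
From mathcomp Require Import mpoly.

Set Implicit Arguments.
Unset Strict Implicit.
Unset Printing Implicit Defensive.

Import GRing.Theory.
Local Open Scope ring_scope.

Record digraph := Digraph {
  vertex :> finType;
  edge : finType;
  src : edge -> vertex;
  tgt : edge -> vertex;
  loopless : forall e : edge, src e != tgt e }.

Arguments src {d} e.
Arguments tgt {d} e.

Section Paths.
Variable G : digraph.
Implicit Types (x y u v w : G) (p : seq (edge G)) (A : {set edge G}).

(* A directed path is its sequence of edges, so that parallel edges give      *)
(* distinct paths. Vertices may repeat: this is irrelevant for reachability   *)
(* and domination, and in [arborescence] it makes uniqueness exclude cycles   *)
(* (a unique simple path would still allow edges back towards the root).      *)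
Fixpoint dipath x p y : bool :=
  if p is e :: p' then (src e == x) && dipath (tgt e) p' y else x == y.

Definition path_vertices x p : seq G := x :: map tgt p.

Definition reachable x y : Prop := exists p, dipath x p y.

Definition strongly_connected : Prop := forall x y, reachable x y.

Definition rooted v : Prop :=
  (forall e : edge G, tgt e != v) /\ (forall w, w != v -> reachable v w).

Definition dominates v u w : Prop :=
  forall p, dipath v p w -> u \in path_vertices v p.

Definition dom v u : {set G} := [set w | `[< dominates v u w >]].

Definition nontrivial_dominator v u : Prop := u <> v /\ dom v u <> [set u].

Definition arborescence A : Prop :=
  exists r, forall w, exists! p, dipath r p w /\ {subset p <= A}.

Definition arb : {set {set edge G}} := [set A | `[< arborescence A >]].

Definition edge_var (e : edge G) : {mpoly rat[#|edge G|]} := 'X_(enum_rank e).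

Definition kirchhoff : {mpoly rat[#|edge G|]} :=
  \sum_(A in arb) \prod_(e in A) edge_var e.

End Paths.

Section Induced.
Variables (G : digraph) (X : {set G}).

Definition induced_vertex : finType := {x : G | x \in X}.
Definition induced_edge : finType :=
  {e : edge G | (src e \in X) && (tgt e \in X)}.

Definition induced_src (e : induced_edge) : induced_vertex :=
  exist _ (src (val e)) (proj1 (andP (valP e))).
Definition induced_tgt (e : induced_edge) : induced_vertex :=
  exist _ (tgt (val e)) (proj2 (andP (valP e))).

Lemma induced_loopless (e : induced_edge) : induced_src e != induced_tgt e.
Proof. exact: loopless (val e). Qed.

Definition induced : digraph := Digraph induced_loopless.

End Induced.

(* Constants, including 0 and 1, are prime in this sense. *)
Definition prime_poly (n : nat) (K : {mpoly rat[n]}) : Prop :=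
  forall P Q : {mpoly rat[n]}, K = P * Q ->
    (exists c : rat, P = c%:MP) \/ (exists c : rat, Q = c%:MP).

(* Main.v *)
(* Let L be the Laplacian of G with a variable on each edge, so that the matrix-tree
   theorem gives kappa = det L; put N = adj L. As kappa has degree 1 in the edges
   entering each x <> v, a factorization kappa = P Q lets only one of P, Q depend on
   that block of variables. If P depends on the block of s and Q on that of t, then
   kappa kappa_ef = kappa_e kappa_f, where the indices mean that the variables of
   e = (a, s) and f = (b, t) have been increased by 1. But rank one updates give
     kappa kappa_ef = kappa_e kappa_f - (N_ts - N_ta) (N_st - N_sb),
   so it suffices to find f with N_st <> N_sb, and symmetrically e.
   If there is none, let Y be the set of x with N_sx = N_st. It contains t and its
   in-neighbours but not v, so some edge (b, y) enters Y with y <> t. Increasing its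
   variable in the identity N_sx = N_sy shows N_yx = N_yy for all x in Y. As
   x |-> N_yx is harmonic off v and y, the maximum principle makes y dominate Y, in
   particular t. *)
Require Import Defs.
From mathcomp Require Import all_boot all_order all_algebra.
From mathcomp Require Import perm boolp mpoly ring.

Set Implicit Arguments.
Unset Strict Implicit.
Unset Printing Implicit Defensive.

Import Order.TTheory GRing.Theory Num.Theory.
Local Open Scope ring_scope.

(** The product has degree 1 and degrees add over a domain, so one factor has degree 0. *)
Lemma mul_eq_XC (R : idomainType) (p q : {poly R}) c :
  c != 0 -> p * q = 'X * c%:P -> (size p <= 1)%N \/ (size q <= 1)%N.
Proof.
move=> c0 /(congr1 (fun r : {poly R} => size r)).
rewrite [in RHS]mulrC mul_polyC size_scale // size_polyX.
have [->|p0] := eqVneq p 0; first by rewrite size_poly0; left.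
have [->|q0] := eqVneq q 0; first by rewrite size_poly0; right.
rewrite size_mul // => sz.
have [|P1] := leqP (size p) 1; [by left | right].
move: sz P1; case: (size p) => [//|[//|n]] /=.
by rewrite !addSn /= addnC; case: (size q) => [|[|]].
Qed.

(** Meant for weights [w1], [w2] obtained from [w] by a change that only [p], respectively only [q],
    can see, with [w12] carrying both changes. *)
Lemma product_exchange (R : comNzRingType) (T : Type) (k p q : T -> R) w w1 w2 w12 :
  (forall u, k u = p u * q u) -> p w12 = p w1 -> q w12 = q w2 ->
  q w1 = q w -> p w2 = p w -> k w * k w12 = k w1 * k w2.
Proof. by move=> kE p12 q12 q1 p2; rewrite !kE p12 q12 q1 p2; ring. Qed.

(** * Laplacian, Green function and rank one updates *)

Section Laplacian.
Variables (G : digraph) (v : G).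
Hypothesis rooted_v : rooted v.

Lemma tgt_neq_root (e : edge G) : tgt e != v.
Proof. by case: rooted_v. Qed.

(* Column [v] is the unit vector at [v], so that this has the same determinant as the
   Laplacian with the row and the column of [v] deleted. *)
Definition lap (R : comNzRingType) (w : edge G -> R) : 'M[R]_#|G| :=
  \matrix_(i, j)
    (\sum_(e | tgt e == enum_val j)
        w e * ((enum_val i == tgt e)%:R - (enum_val i == src e)%:R)
     + ((enum_val j == v) && (enum_val i == v))%:R).

Definition tree_poly (R : comNzRingType) (w : edge G -> R) : R := \det (lap w).

(** A Green function cleared of denominators: where [lap w] is invertible, this is [tree_poly w]
    times an entry of its inverse. *)
Definition green (R : comNzRingType) (w : edge G -> R) (s x : G) : R :=
  (\adj (lap w)) (enum_rank s) (enum_rank x).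

(** Zero inflow at [x] means that [y] is harmonic there with respect to the sources of the edges
    entering [x]. *)
Definition inflow (R : comNzRingType) (w : edge G -> R) (y : G -> R) (x : G) : R :=
  \sum_(e | tgt e == x) w e * (y (tgt e) - y (src e)).

Lemma sum_enum_val (R : comNzRingType) (F : G -> R) :
  \sum_(i < #|G|) F (enum_val i) = \sum_x F x.
Proof.
rewrite (reindex _ (onW_bij _ (enum_rank_bij G))).
by apply: eq_bigr => x _; rewrite enum_rankK.
Qed.

Lemma sum_mul_delta (R : comNzRingType) (F : G -> R) z :
  \sum_x F x * (x == z)%:R = F z.
Proof.
rewrite (bigD1 z) //= eqxx mulr1 big1 ?addr0 // => x /negPf ->.
by rewrite mulr0.
Qed.

Lemma mulmx_lap (R : comNzRingType) (w : edge G -> R) (y : 'rV[R]_#|G|) (j : 'I_#|G|) :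
  (y *m lap w) 0 j =
  inflow w (fun x => y 0 (enum_rank x)) (enum_val j) +
  (enum_val j == v)%:R * y 0 (enum_rank v).
Proof.
pose Y x := y 0 (enum_rank x).
rewrite mxE.
transitivity (\sum_x Y x * (\sum_(e | tgt e == enum_val j)
        w e * ((x == tgt e)%:R - (x == src e)%:R)
     + ((enum_val j == v) && (x == v))%:R)).
  rewrite -sum_enum_val; apply: eq_bigr => i _.
  by rewrite mxE /Y enum_valK.
under eq_bigr do rewrite mulrDr mulr_sumr.
rewrite big_split exchange_big /=; congr (_ + _).
  apply: eq_bigr => e _; rewrite -/(Y (tgt e)) -/(Y (src e)).
  under eq_bigr do rewrite mulrCA mulrBr.
  by rewrite -mulr_sumr sumrB !sum_mul_delta.
case: (enum_val j == v) => /=; first by rewrite mul1r sum_mul_delta.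
by rewrite mul0r big1 // => x _; rewrite mulr0.
Qed.

Lemma inflow_root (R : comNzRingType) (w : edge G -> R) y : inflow w y v = 0.
Proof. by rewrite /inflow big1 // => e; rewrite (negPf (tgt_neq_root e)). Qed.

Lemma green_row (R : comNzRingType) (w : edge G -> R) s x :
  inflow w (green w s) x + (x == v)%:R * green w s v = tree_poly w *+ (s == x).
Proof.
have -> : tree_poly w *+ (s == x)
          = (\adj (lap w) *m lap w) (enum_rank s) (enum_rank x).
  by rewrite mul_adj_mx mxE (inj_eq enum_rank_inj).
have := mulmx_lap w (row (enum_rank s) (\adj (lap w))) (enum_rank x).
have rE a : row (enum_rank s) (\adj (lap w)) 0 (enum_rank a) = green w s a.
  by rewrite mxE.
rewrite -row_mul [LHS]mxE enum_rankK rE => ->; congr (_ + _).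
by apply: eq_bigr => e _; rewrite !rE.
Qed.

(** No edge enters [v], so only the unit entry of column [v] survives in [green_row]. *)
Lemma green_root (R : comNzRingType) (w : edge G -> R) s :
  s != v -> green w s v = 0.
Proof.
by move=> sv; have := green_row w s v; rewrite inflow_root eqxx add0r mul1r (negPf sv).
Qed.

Lemma inflow_green (R : comNzRingType) (w : edge G -> R) s x :
  s != v -> inflow w (green w s) x = tree_poly w *+ (s == x).
Proof. by move=> sv; rewrite -green_row green_root // mulr0 addr0. Qed.

(* The cofactors in row [s] of the adjugate do not see column [s]. *)
Lemma eq_green (R : comNzRingType) (w w' : edge G -> R) s :
  (forall e, tgt e != s -> w e = w' e) -> green w s =1 green w' s.
Proof.
move=> eq_w x; rewrite /green !mxE /cofactor; congr (_ * \det _).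
apply/matrixP=> i j; rewrite !mxE; congr (_ + _).
apply: eq_bigr => e /eqP te; rewrite eq_w // te.
apply: contra (neq_lift (enum_rank s) j) => /eqP Es.
by apply/eqP/enum_val_inj; rewrite enum_rankK.
Qed.

Definition bump (R : comNzRingType) (w : edge G -> R) (e e' : edge G) : R :=
  w e' + (e' == e)%:R.

Lemma inflow_bump (R : comNzRingType) (w : edge G -> R) e y x :
  inflow (bump w e) y x = inflow w y x + (y (tgt e) - y (src e)) *+ (tgt e == x).
Proof.
rewrite /inflow /bump; under eq_bigr do rewrite mulrDl.
rewrite big_split /=; congr (_ + _).
rewrite big_mkcond (bigD1 e) //= eqxx mul1r big1 ?addr0; first by case: eqP.
by move=> e' /negPf ->; rewrite mul0r if_same.
Qed.

(** Row [tgt e] of the adjugate ignores the weight of [e], so only the explicit term of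
    [inflow_bump] changes. *)
Lemma tree_poly_bump (R : comNzRingType) (w : edge G -> R) e :
  tree_poly (bump w e) =
  tree_poly w + (green w (tgt e) (tgt e) - green w (tgt e) (src e)).
Proof.
have eq_g : green (bump w e) (tgt e) =1 green w (tgt e).
  apply: eq_green => e' ne; rewrite /bump (_ : (e' == e) = false) ?addr0 //.
  by apply: contraNF ne => /eqP->.
have tv := tgt_neq_root e.
have := inflow_green (bump w e) (tgt e) tv.
rewrite inflow_bump !eq_g !eqxx !mulr1n => <-.
congr (_ + _); have := inflow_green w (tgt e) tv; rewrite eqxx mulr1n => <-.
by apply: eq_bigr => e' _; rewrite !eq_g.
Qed.

Lemma inflow_inj (R : idomainType) (w : edge G -> R) (y z : G -> R) :
  tree_poly w != 0 -> y v = z v ->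
  (forall x, x != v -> inflow w y x = inflow w z x) -> y =1 z.
Proof.
move=> w0 yzv yz x.
pose row_of (y : G -> R) : 'rV[R]_#|G| := \row_i y (enum_val i).
have row_ofE u a : row_of u 0 (enum_rank a) = u a by rewrite mxE enum_rankK.
have eqm : row_of y *m lap w = row_of z *m lap w.
  apply/rowP=> j; rewrite !mulmx_lap !row_ofE yzv; congr (_ + _).
  have fE u : inflow w (fun x => row_of u 0 (enum_rank x)) =1 inflow w u.
    by move=> a; apply: eq_bigr => e _; rewrite !row_ofE.
  rewrite !fE; have [->|] := eqVneq (enum_val j) v; last exact: yz.
  by rewrite !inflow_root.
have := congr1 (fun A => A *m \adj (lap w)) eqm.
rewrite /= -!mulmxA mul_mx_adj !mul_mx_scalar => /rowP/(_ (enum_rank x)).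
by rewrite !mxE enum_rankK => /(mulfI w0).
Qed.

(** The Sherman-Morrison formula without denominators. Both sides vanish at [v] and have the same
    inflow for the raised weights, so [inflow_inj] identifies them. *)
Lemma green_bump (R : idomainType) (w : edge G -> R) e t x :
  t != v -> t != tgt e -> tree_poly (bump w e) != 0 ->
  tree_poly w * green (bump w e) t x =
  tree_poly (bump w e) * green w t x
  - (green w t (tgt e) - green w t (src e)) * green w (tgt e) x.
Proof.
move=> tv te k0; set s := tgt e in te *.
pose y x := tree_poly w * green (bump w e) t x.
pose z x := tree_poly (bump w e) * green w t x
  - (green w t s - green w t (src e)) * green w s x.
have sv : s != v := tgt_neq_root e.
have inflow_lin a b u u' c : inflow w (fun x : G => a * u x - b * u' x) c =
   a * inflow w u c - b * inflow w u' c.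
  by rewrite /inflow !mulr_sumr -sumrB; apply: eq_bigr => e' _; ring.
have inflow_lin1 w' a u c : inflow w' (fun x : G => a * u x) c = a * inflow w' u c.
  by rewrite /inflow !mulr_sumr; apply: eq_bigr => e' _; ring.
apply: (@inflow_inj _ (bump w e) y z) => //.
  by rewrite /y /z !green_root // !mulr0 subr0.
move=> {}x xv; rewrite inflow_lin1 inflow_green // inflow_bump inflow_lin.
rewrite !inflow_green // /z -/s tree_poly_bump -/s.
have [tx|_] := eqVneq t x; have [sx|_] := eqVneq s x; rewrite ?mulr0n ?mulr1n.
- by case/eqP: te; rewrite tx.
all: ring.
Qed.

(** Subtracting [green_bump] at [x] and at [y] leaves a nonzero multiple of the difference in row
    [tgt e]. *)
Lemma green_bump_eq (R : idomainType) (w : edge G -> R) e t x y :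
  t != v -> t != tgt e -> tree_poly (bump w e) != 0 ->
  green w t (tgt e) != green w t (src e) ->
  green w t x = green w t y -> green (bump w e) t x = green (bump w e) t y ->
  green w (tgt e) x = green w (tgt e) y.
Proof.
move=> tv te k0 ne xy xy'.
have := green_bump x tv te k0; rewrite xy' xy (green_bump y tv te k0).
by move/addrI/oppr_inj/mulfI => -> //; rewrite subr_eq0.
Qed.

Lemma tree_poly_bump2 (R : idomainType) (w : edge G -> R) e f :
  tgt f != tgt e -> tree_poly (bump w e) != 0 ->
  tree_poly w * tree_poly (bump (bump w e) f) =
  tree_poly (bump w e) * tree_poly (bump w f)
  - (green w (tgt f) (tgt e) - green w (tgt f) (src e))
    * (green w (tgt e) (tgt f) - green w (tgt e) (src f)).
Proof.
move=> fe k0; have gb x := green_bump x (tgt_neq_root f) fe k0.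
have -> := tree_poly_bump (bump w e) f; have -> := tree_poly_bump w f.
rewrite mulrDr mulrBr (gb (tgt f)) (gb (src f)); ring.
Qed.

Lemma tree_poly_bump2_neq (R : idomainType) (w : edge G -> R) e f :
  tgt f != tgt e -> tree_poly (bump w e) != 0 ->
  green w (tgt f) (tgt e) != green w (tgt f) (src e) ->
  green w (tgt e) (tgt f) != green w (tgt e) (src f) ->
  tree_poly w * tree_poly (bump (bump w e) f)
  != tree_poly (bump w e) * tree_poly (bump w f).
Proof.
move=> fe k0 ne nf; have -> := tree_poly_bump2 fe k0.
by rewrite -subr_eq0 addrAC subrr sub0r oppr_eq0 mulf_neq0 // subr_eq0.
Qed.

Lemma lap_map (A B : comNzRingType) (phi : {rmorphism A -> B}) (w : edge G -> A) :
  map_mx phi (lap w) = lap (phi \o w).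
Proof.
apply/matrixP=> i j; rewrite !mxE rmorphD rmorph_sum rmorph_nat; congr (_ + _).
by apply: eq_bigr => e _; rewrite rmorphM rmorphB !rmorph_nat.
Qed.

Lemma tree_poly_map (A B : comNzRingType) (phi : {rmorphism A -> B}) (w : edge G -> A) :
  phi (tree_poly w) = tree_poly (phi \o w).
Proof. by rewrite /tree_poly -det_map_mx lap_map. Qed.

Lemma green_map (A B : comNzRingType) (phi : {rmorphism A -> B}) (w : edge G -> A) s x :
  phi (green w s x) = green (phi \o w) s x.
Proof. by rewrite /green -lap_map -map_mx_adj [RHS]mxE. Qed.

(** * Maximum principle for positive weights *)

Section MaximumPrinciple.
Variables (F : realDomainType) (w : edge G -> F).
Hypothesis w_gt0 : forall e, 0 < w e.

Lemma inflow_max (y : G -> F) c e :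
  (forall z, y z <= c) -> inflow w y (tgt e) = 0 -> y (tgt e) = c -> y (src e) = c.
Proof.
move=> y_le y0 yc.
have ge0 e' : tgt e' == tgt e -> 0 <= w e' * (y (tgt e') - y (src e')).
  by move=> /eqP->; apply: mulr_ge0; rewrite ?subr_ge0 ?yc //; apply: ltW.
have /eqP := psumr_eq0P ge0 y0 (eqxx (tgt e)).
by rewrite mulf_eq0 gt_eqF //= subr_eq0 yc => /eqP.
Qed.

(** By [inflow_max] the maximal value [c] passes backwards along the path until it meets [D] or the
    starting point. *)
Lemma path_max (D : pred G) (y : G -> F) c u p x :
  (forall z, y z <= c) -> (forall z, ~~ D z -> inflow w y z = 0) ->
  dipath u p x -> y x = c ->
  exists z, [/\ z \in path_vertices u p, y z = c & z = u \/ D z].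
Proof.
move=> y_le y0; elim: p u => [|e p IHp] u /=.
  by move=> /eqP-> yx; exists x; rewrite mem_head; split=> //; left.
case/andP=> /eqP <- px yx; have [z [zp yz Dz]] := IHp _ px yx.
have [Dz'|nDz] := boolP (D z).
  by exists z; split; [rewrite inE zp orbT | | right].
case: Dz => [ez|]; last by rewrite (negPf nDz).
exists (src e); split; [exact: mem_head | | by left].
by apply: inflow_max; rewrite -?ez // y0.
Qed.

(** Following a path from [v] back from a maximum point ends in [D], since [v] itself lies in
    [D]. *)
Lemma boundary_max (D : pred G) (y : G -> F) x :
  D v -> (forall z, ~~ D z -> inflow w y z = 0) ->
  exists2 d, D d & y x <= y d.
Proof.
move=> Dv y0; pose m := [arg max_(z > v) y z]%O.
have m_max z : y z <= y m by rewrite /m; case: arg_maxP => // i _; exact.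
have [p pm] : reachable v m.
  have [->|mv] := eqVneq m v; first by exists [::] => /=.
  by case: rooted_v => _; exact.
have [z [_ yz Dz]] := path_max m_max y0 pm erefl.
by exists z; [case: Dz => [->|] | rewrite yz].
Qed.

Lemma inflowN (y : G -> F) x : inflow w (fun z => - y z) x = - inflow w y x.
Proof.
by rewrite /inflow -sumrN; apply: eq_bigr => e _; rewrite -mulrN opprB opprK addrC.
Qed.

Lemma potential0 (s : G) (y : G -> F) x :
  y v = 0 -> y s = 0 -> (forall z, ~~ pred2 v s z -> inflow w y z = 0) ->
  y x = 0.
Proof.
have Dv : pred2 v s v by rewrite /= eqxx.
move=> yv ys y0; apply/le_anti/andP; split; last rewrite -oppr_le0.
  by have [d /pred2P[]-> ] := boundary_max x Dv y0; rewrite ?yv ?ys.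
have y0' z : ~~ pred2 v s z -> inflow w (fun a => - y a) z = 0.
  by move=> zvs; rewrite inflowN y0 // oppr0.
by have [d /pred2P[]-> ] := boundary_max x Dv y0'; rewrite ?yv ?ys oppr0.
Qed.

Lemma tree_poly_neq0 : tree_poly w != 0.
Proof.
apply/det0P => -[r r0 rL]; case/negP: r0; apply/eqP/rowP=> j.
pose y (x : G) : F := r 0 (enum_rank x).
have yL x : inflow w y x + (x == v)%:R * y v = 0.
  have := mulmx_lap w r (enum_rank x); rewrite rL mxE enum_rankK => <- //.
have yv : y v = 0 by have := yL v; rewrite inflow_root eqxx mul1r add0r.
(* A kernel vector is harmonic off [v] and zero at [v]: the boundary is [v] alone, taken twice. *)
rewrite -[j]enum_valK mxE; apply: (@potential0 v y _ yv yv) => z _.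
by have := yL z; rewrite yv mulr0 addr0.
Qed.

(** Otherwise [green w s] would vanish on the whole boundary, hence everywhere, although its inflow
    at [s] is the nonzero [tree_poly w]. *)
Lemma green_diag_neq0 s : s != v -> green w s s != 0.
Proof.
move=> sv; apply: contraNneq tree_poly_neq0 => gs.
have := inflow_green w s sv; rewrite eqxx mulr1n => <-.
have y0 z : ~~ pred2 v s z -> inflow w (green w s) z = 0.
  by rewrite negb_or (inflow_green w z sv) => /andP[_]; rewrite eq_sym => /negPf->.
have g0 x : green w s x = 0 by apply: (potential0 x (green_root w sv) gs y0).
by rewrite /inflow big1 // => e _; rewrite !g0 subrr mulr0.
Qed.

(** If [y s] is positive it is the maximum, so every path from [v] to [x] carries it back to a
    boundary point; this cannot be [v], where [y] is 0. *)
Lemma potential_dominates (s : G) (y : G -> F) x :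
  y v = 0 -> y s != 0 -> (forall z, ~~ pred2 v s z -> inflow w y z = 0) ->
  y x = y s -> dominates v s x.
Proof.
move=> yv ys y0; wlog ys_gt0 : y yv ys y0 / 0 < y s => [gt0|].
  have [/gt0|] := ltP 0 (y s); first exact.
  move=> ys_le0 yx; apply: (gt0 (fun z => - y z)); rewrite ?yv ?yx ?oppr_eq0 ?oppr0 //.
    by move=> z zv; rewrite inflowN y0 // oppr0.
  by rewrite oppr_gt0 lt_neqAle ys.
move=> yx p px.
have y_le z : y z <= y s.
  have [|d] := @boundary_max (pred2 v s) y z _ y0; first by rewrite /= eqxx.
  by case/pred2P=> -> // /le_trans; apply; rewrite yv ltW.
have [z [zp yz]] := path_max y_le y0 px yx.
have zv : z <> v by move=> ez; rewrite -yz ez yv eqxx in ys.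
by case=> [//|/pred2P[//|<-]].
Qed.

Lemma potential_neq0 (s : G) (y : G -> F) x p :
  y v = 0 -> y s != 0 -> (forall z, ~~ pred2 v s z -> inflow w y z = 0) ->
  dipath s p x -> v \notin map tgt p -> y x != 0.
Proof.
(* Making [y s] negative turns 0 into the maximum; a zero at [x] would then travel back along [p],
   which does not enter [v], to [s]. *)
move=> yv ys y0; wlog ys_lt0 : y yv ys y0 / y s < 0 => [lt0|].
  have [/lt0|] := ltP (y s) 0; first exact.
  move=> ys_ge0 px vp; rewrite -oppr_eq0.
  apply: (lt0 (fun z => - y z)); rewrite ?yv ?oppr_eq0 ?oppr0 //.
    by move=> z zv; rewrite inflowN y0 // oppr0.
  by rewrite oppr_lt0 lt_neqAle eq_sym ys.
move=> px vp; apply/eqP => yx.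
have y_le z : y z <= 0.
  have [|d] := @boundary_max (pred2 v s) y z _ y0; first by rewrite /= eqxx.
  by case/pred2P=> ->; rewrite ?yv // => /le_trans; apply; rewrite ltW.
have sv : s != v by apply: contraNneq ys => ->; rewrite yv.
have [z [zp yz Dz]] := path_max y_le y0 px yx.
have zv : z <> v.
  move: zp; rewrite inE => /orP[/eqP-> | zp /esym ez]; first exact/eqP.
  by rewrite ez zp in vp.
case: Dz => [ez|/pred2P[//|ez]]; by rewrite -ez yz eqxx in ys.
Qed.

Lemma inflow_green_off s z :
  s != v -> ~~ pred2 v s z -> inflow w (green w s) z = 0.
Proof.
move=> sv; rewrite negb_or => /andP[_ zs].
by rewrite inflow_green // eq_sym (negPf zs).
Qed.

End MaximumPrinciple.

(** * Polynomial weights and substitution *)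

Local Notation Q_G := {mpoly rat[#|edge G|]}.

Local Notation subst h w := (mmap h (w \o @enum_val (edge G) (edge G))).

Lemma subst_var (A : comNzRingType) (h : {rmorphism rat -> A}) (w : edge G -> A) :
  subst h w \o @edge_var G = w.
Proof.
apply/funext=> e /=; rewrite /edge_var mmapX mmap1U /=.
by rewrite enum_rankK.
Qed.

Lemma rmorph_subst (A B : comNzRingType) (phi : {rmorphism A -> B}) (h : rat -> A)
    (w : edge G -> A) (P : Q_G) :
  phi (subst h w P) = subst (phi \o h) (phi \o w) P.
Proof.
rewrite /mmap rmorph_sum; apply: eq_bigr => m _.
rewrite rmorphM rmorph_prod; congr (_ * _).
by apply: eq_bigr => i _; rewrite rmorphXn.
Qed.

Lemma subst_id (P : Q_G) : subst (@mpolyC _ rat) (@edge_var G) P = P.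
Proof.
rewrite [RHS]mpolyE; apply: eq_bigr => m _; rewrite mul_mpolyC; congr (_ *: _).
rewrite -mmap1_id; apply: eq_bigr => i _; congr (_ ^+ _).
by rewrite /= /edge_var enum_valK.
Qed.

(** Setting all variables to 1 gives positive rational weights, to which the maximum principle
    applies. *)
Lemma subst1_tree_poly (w : edge G -> Q_G) :
  (forall e, 0 < subst idfun (fun=> 1) (w e)) -> tree_poly w != 0.
Proof.
move=> w_gt0; have := tree_poly_neq0 w_gt0.
apply: contraNneq => w0; rewrite -[X in tree_poly X]/(subst idfun (fun=> 1) \o w).
by rewrite -tree_poly_map w0 rmorph0.
Qed.

Lemma tree_poly_var_neq0 : tree_poly (@edge_var G) != 0.
Proof.
apply: subst1_tree_poly => e.
by have /(congr1 (@^~ e)) /= -> := subst_var (idfun : {rmorphism rat -> rat}) (fun=> 1).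
Qed.

Lemma tree_poly_bump_neq0 f : tree_poly (bump (@edge_var G) f) != 0.
Proof.
apply: subst1_tree_poly => e; rewrite rmorphD rmorph_nat.
have /(congr1 (@^~ e)) /= -> := subst_var (idfun : {rmorphism rat -> rat}) (fun=> 1).
by rewrite ltr_wpDr ?ler0n.
Qed.

(** * Separation of vertices by Green functions *)

Hypothesis strong_v : strongly_connected (induced (~: [set v])).
Hypothesis dom_v : forall u : G, ~ nontrivial_dominator v u.

Lemma reach_off_root x y : x != v -> y != v ->
  exists2 p, dipath x p y & v \notin map tgt p.
Proof.
move=> xv yv.
have xI : x \in ~: [set v] by rewrite !inE.
have yI : y \in ~: [set v] by rewrite !inE.
have [p] := @strong_v (exist _ x xI) (exist _ y yI).
(* Writing the endpoints as projections lets the induction range over vertices of the induced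
   digraph. *)
rewrite -{2}[x]/(val (exist (fun x => x \in ~: [set v]) x xI)).
rewrite -{2}[y]/(val (exist (fun x => x \in ~: [set v]) y yI)).
elim: p (exist _ x _) => [|e p IHp] z /=.
  by move=> /eqP-> ; exists [::] => //=.
case/andP=> /eqP ez /IHp[q qy vq]; exists (val e :: q) => /=.
  by rewrite -ez eqxx.
by rewrite inE negb_or vq eq_sym tgt_neq_root.
Qed.

Lemma dominates_eq u x : u != v -> dominates v u x -> x = u.
Proof.
move=> uv ux; have nt := @dom_v u.
have [domu|domu] := eqVneq (dom v u) [set u].
  by apply/eqP; rewrite -in_set1 -domu inE; apply/asboolP.
by case: nt; split; apply/eqP.
Qed.


Let X := @edge_var G.

Let ones : edge G -> rat := fun=> 1.
Let ones_gt0 e : 0 < ones e. Proof. by []. Qed.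

Lemma green_ones s x : subst idfun ones (green X s x) = green ones s x.
Proof. by rewrite green_map subst_var. Qed.

(** With all variables set to 1, the equality makes [s] a dominator of [x]. *)
Lemma green_inj s x : s != v -> green X s x = green X s s -> x = s.
Proof.
move=> sv /(congr1 (subst idfun ones)); rewrite !green_ones => eq_g.
apply: (dominates_eq sv).
apply: (@potential_dominates _ _ ones_gt0 s (green ones s) x _ _ _ eq_g).
- exact: green_root.
- exact: green_diag_neq0.
- by move=> z; apply: inflow_green_off.
Qed.

Lemma green_neq0 s x : s != v -> x != v -> green X s x != 0.
Proof.
move=> sv xv; have [p px vp] := reach_off_root sv xv.
suff : green ones s x != 0.
  by apply: contraNneq => g0; rewrite -green_ones g0 rmorph0.
apply: (@potential_neq0 _ _ ones_gt0 s (green ones s) x p _ _ _ px vp).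
- exact: green_root.
- exact: green_diag_neq0.
- by move=> z; apply: inflow_green_off.
Qed.

Lemma green_subst_bump f s x :
  subst (@mpolyC _ rat) (bump X f) (green X s x) = green (bump X f) s x.
Proof. by rewrite green_map subst_var. Qed.

(* Polynomial identities survive the substitution [X_f -> X_f + 1]. *)
Lemma green_level s f x :
  s != v -> s != tgt f -> green X s (tgt f) != green X s (src f) ->
  green X s x = green X s (tgt f) -> x = tgt f.
Proof.
move=> sv sf neq eq_x; apply: (green_inj (tgt_neq_root f)).
(* The equality in row [s] holds before and after raising [f], so it passes to row [tgt f]. *)
apply: (green_bump_eq sv sf (tree_poly_bump_neq0 f) neq eq_x).
by rewrite -!green_subst_bump eq_x.
Qed.

(** Otherwise the value at [t] propagates backwards along a path from [v], giving [green X s t] the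
    value 0 found at [v], against [green_neq0]. *)
Lemma green_separates s t : s != v -> t != v -> s != t ->
  exists2 f, tgt f = t & green X s t != green X s (src f).
Proof.
move=> sv tv st; apply: contrapT => no_f.
have in_t f : tgt f = t -> green X s (src f) = green X s t.
  by move=> ft; apply/esym/eqP/negP=> ne; apply: no_f; exists f => //; apply/negP.
have [p] : reachable v t by case: rooted_v => _; exact.
suff H q x : dipath x q t -> green X s x = green X s t.
  by move/H; rewrite green_root // => /esym/eqP; apply/negP/green_neq0.
elim: q x => [|f q IHq] x /=; first by move=> /eqP->.
case/andP=> /eqP <- /IHq eq_t.
(* If the value changes across [f], then [green_level] forces [tgt f = t], where no change was
   allowed. *)
have [->//|ne] := eqVneq (green X s (src f)) (green X s t).
have st' : s != tgt f.
  apply: contraNneq st => es; rewrite (@green_inj s t) // -eq_t {2}es.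
  by rewrite es.
rewrite in_t //; apply/esym; apply: green_level (esym eq_t) => //.
by rewrite eq_t eq_sym.
Qed.

Lemma tree_poly_not_separable s t : s != v -> t != v -> s != t ->
  exists e f, [/\ tgt e = s, tgt f = t &
    tree_poly X * tree_poly (bump (bump X e) f)
    != tree_poly (bump X e) * tree_poly (bump X f)].
Proof.
move=> sv tv st; have ts : t != s by rewrite eq_sym.
have [e es ne_e] := green_separates tv sv ts.
have [f ft ne_f] := green_separates sv tv st.
exists e, f; split=> //.
apply: (tree_poly_bump2_neq _ (tree_poly_bump_neq0 e)); by rewrite ?es ?ft.
Qed.

(** * Dependence on the block of edges entering a vertex *)

Definition scale_block (A : comNzRingType) (w : edge G -> A) x l (e : edge G) : A :=
  if tgt e == x then l * w e else w e.

(** The block of [x] fills column [x] of the matrix, so scaling it multiplies that column by [l]. *)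
Lemma tree_poly_scale (A : comNzRingType) (w : edge G -> A) x l : x != v ->
  tree_poly (scale_block w x l) = l * tree_poly w.
Proof.
move=> xv.
pose d : 'rV[A]_#|G| := \row_j (if j == enum_rank x then l else 1).
have dE j : d 0 j = if j == enum_rank x then l else 1 by rewrite mxE.
have lapE : lap (scale_block w x l) = lap w *m diag_mx d.
  apply/matrixP=> i j; rewrite mul_mx_diag !mxE.
  have [->|jx] := eqVneq j (enum_rank x).
    rewrite enum_rankK (negPf xv) /= !addr0 mulr_suml.
    by apply: eq_bigr => e ex; rewrite /scale_block ex; ring.
  rewrite mulr1; congr (_ + _); apply: eq_bigr => e /eqP ej.
  rewrite /scale_block ifN // ej; apply: contra jx => /eqP <-.
  by rewrite enum_valK.
rewrite /tree_poly lapE det_mulmx det_diag mulrC; congr (_ * _).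
rewrite (bigD1 (enum_rank x)) //= dE eqxx big1 ?mulr1 // => j /negPf jx.
by rewrite dE jx.
Qed.

Local Notation at_weights w := (subst (@mpolyC #|edge G| rat) w).

(** Independence of a block of variables, encoded as invariance under setting them to 0. *)
Definition block_free x (P : Q_G) := at_weights (scale_block X x 0) P = P.

(** Both weights may be set to 0 on the block first, after which they coincide. *)
Lemma block_freeP x P (w w' : edge G -> Q_G) : block_free x P ->
  (forall e, tgt e != x -> w e = w' e) -> at_weights w P = at_weights w' P.
Proof.
have free u : block_free x P -> at_weights u P = at_weights (scale_block u x 0) P.
  move=> Px; rewrite -{1}Px rmorph_subst; congr (mmap _ _ _); apply/funext=> a /=.
    by rewrite mmapC.
  have uX e : at_weights u (X e) = u e.
    by have /(congr1 (@^~ e)) := subst_var (@mpolyC _ rat) u.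
  by rewrite /scale_block; case: ifP => _; rewrite ?mul0r ?rmorph0 ?uX.
move=> Px ww'; rewrite (free w) // (free w') //; congr (mmap _ _ _).
apply/funext=> i; rewrite /= /scale_block; case: ifPn => [_|/ww'//].
by rewrite !mul0r.
Qed.

Lemma free_const P : (forall x, x != v -> block_free x P) -> exists c : rat, P = c%:MP.
Proof.
move=> Pfree; exists (mmap idfun (fun=> 0) P).
have -> : (mmap idfun (fun=> 0) P)%:MP = at_weights (fun=> 0) P.
  rewrite /mmap rmorph_sum; apply: eq_bigr => m _; rewrite rmorphM rmorph_prod.
  by congr (_ * _); apply: eq_bigr => i _; rewrite rmorphXn rmorph0.
pose w (r : seq G) e := if tgt e \in r then 0 else X e.
have P_w r : v \notin r -> at_weights (w r) P = P.
  elim: r => [|x r IHr]; first by rewrite -[RHS]subst_id.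
  rewrite inE negb_or => /andP[vx vr]; rewrite -[RHS]IHr //.
  apply: (@block_freeP x); first by apply: Pfree; rewrite eq_sym.
  by move=> e /negPf ex; rewrite /w inE ex.
(* Every edge enters a vertex other than [v], so erasing these blocks erases all variables. *)
rewrite -[LHS](P_w (rem v (enum G))); last by rewrite mem_rem_uniqF ?enum_uniq.
congr (mmap _ _ _); apply/funext=> i /=.
by rewrite /w mem_rem_uniq ?enum_uniq // !inE tgt_neq_root mem_enum.
Qed.

(** * Factorizations of the tree polynomial *)

Section Factors.
Variables P Q : Q_G.
Hypothesis factors : tree_poly X = P * Q.

(* Scaling the variables of the edges into [x] by ['X] multiplies the
   polynomial by ['X], whose degree cannot be shared by both factors. *)
Lemma factor_free x : x != v -> block_free x P \/ block_free x Q.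
Proof.
move=> xv; pose h : {rmorphism rat -> {poly Q_G}} := polyC \o @mpolyC #|edge G| rat.
pose w := scale_block (polyC \o X) x 'X.
(* A polynomial constant in ['X] has equal values at 0, which erases the block, and at 1, which
   changes nothing. *)
have free R : (size (subst h w R) <= 1)%N -> block_free x R.
  move/size1_polyC => cR.
  have ev a : at_weights (scale_block X x a) R = (subst h w R).[a].
    rewrite (_ : _.[a] = horner_eval a (subst h w R)) // rmorph_subst.
    congr (mmap _ _ _); apply/funext=> i /=.
      by rewrite /horner_eval hornerC.
    by rewrite /w /scale_block; case: ifP => _; rewrite /horner_eval !hornerE.
  have ev1 : at_weights (scale_block X x 1) R = R.
    rewrite -[RHS]subst_id; congr (mmap _ _ _); apply/funext=> i /=.
    by rewrite /scale_block mul1r if_same.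
  by rewrite /block_free -[RHS]ev1 !ev cR !hornerC.
have : subst h w P * subst h w Q = 'X * (tree_poly X)%:P.
  rewrite -rmorphM -factors tree_poly_map subst_var tree_poly_scale //.
  by rewrite tree_poly_map.
by case/(mul_eq_XC tree_poly_var_neq0) => /free; [left | right].
Qed.

Lemma factors_trivial : (exists c : rat, P = c%:MP) \/ (exists c : rat, Q = c%:MP).
Proof.
have [?|nP] := pselect (exists c : rat, P = c%:MP); [by left | right].
apply: free_const => t tv; apply: contrapT => nQt.
apply: nP; apply: free_const => s sv; apply: contrapT => nPs.
(* [P] depends on the block of [s] and [Q] on that of [t], so each is free of the other block. *)
have Qs : block_free s Q by case: (factor_free sv).
have Pt : block_free t P by case: (factor_free tv).
have st : s != t by apply: contra_notN nPs => /eqP->.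
have [e [f [es ft]]] := tree_poly_not_separable sv tv st.
have PQ w : tree_poly w = at_weights w P * at_weights w Q.
  by rewrite -rmorphM -factors tree_poly_map subst_var.
have bumpP w g r R : tgt g = r -> block_free r R ->
    at_weights (bump w g) R = at_weights w R.
  move=> gr /block_freeP; apply=> e' e'r; rewrite /bump.
  rewrite (_ : (e' == g) = false) ?addr0 //.
  by apply: contraNF e'r => /eqP->; rewrite gr.
have bumpC : bump (bump X e) f = bump (bump X f) e.
  by apply/funext => g; rewrite /bump addrAC.
case/negP; apply/eqP; apply: (product_exchange PQ).
- exact: bumpP ft Pt.
- by rewrite bumpC; apply: bumpP es Qs.
- exact: bumpP es Qs.
- exact: bumpP ft Pt.
Qed.

End Factors.

(** * The matrix-tree theorem *)

Lemma dipath_rcons x p (e : edge G) y :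
  dipath x (rcons p e) y = dipath x p (src e) && (tgt e == y).
Proof.
elim: p x => [|e' p IHp] x /=; first by rewrite eq_sym.
by rewrite IHp andbA.
Qed.

(* [f] selects the edge entering each vertex, and [None] exactly at the root. *)
Implicit Type f : {ffun 'I_#|G| -> option (edge G)}.

Definition enters (j : 'I_#|G|) (o : option (edge G)) : bool :=
  if o is Some e then tgt e == enum_val j else enum_val j == v.

Definition parent f (x : G) : G :=
  if f (enum_rank x) is Some e then src e else x.

(** For an admissible choice, following parents leads either into a cycle or to [v], which is its
    own parent. *)
Definition acyclic f : bool := [forall x, fconnect (parent f) x v].

Definition arcs f : {set edge G} := [set e | f (enum_rank (tgt e)) == Some e].

Definition choice_mx (A : comNzRingType) f : 'M[A]_#|G| :=
  \matrix_(i, j) ((i == j)%:R -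
    if f j is Some e then (enum_val i == src e)%:R else 0).

(** Multilinearity of the determinant in the columns: column [j] is a sum over the edges entering
    [j], with [None] giving the unit vector at [v]. *)
Lemma tree_poly_choices (A : comNzRingType) (w : edge G -> A) :
  tree_poly w =
  \sum_(f in family enters)
     (\prod_j if f j is Some e then w e else 1) * \det (choice_mx A f).
Proof.
pose D (i j : 'I_#|G|) (o : option (edge G)) : A :=
  (i == j)%:R - if o is Some e then (enum_val i == src e)%:R else 0.
pose W (o : option (edge G)) : A := if o is Some e then w e else 1.
have lapE i j : lap w i j = \sum_(o | enters j o) W o * D i j o.
  rewrite mxE [RHS]big_mkcond [RHS](bigD1 None) //= [LHS]addrC; congr (_ + _).
    rewrite /W /D /= mul1r subr0 -(inj_eq enum_val_inj).
    by case: eqP => [->|_]; case: eqP => //= _; case: eqP.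
  rewrite -big_mkcondr (reindex_omap Some id) /=; last by case.
  apply: eq_big => [e|e /eqP te]; first by rewrite eqxx andbT.
  by rewrite /D te (inj_eq enum_val_inj).
(* After transposition the Leibniz products run over columns, as the choices do. *)
rewrite /tree_poly -det_tr [in LHS]/determinant.
under eq_bigr => s _.
  under eq_bigr do rewrite mxE lapE.
  rewrite bigA_distr_big_dep mulr_sumr; over.
rewrite exchange_big /=; apply: eq_bigr => f _.
rewrite -det_tr /determinant mulr_sumr; apply: eq_bigr => s _.
rewrite big_split mulrCA; congr (_ * (_ * _)).
by apply: eq_bigr => j _; rewrite !mxE.
Qed.

Lemma parent_neq f x : f \in family enters -> x != v -> parent f x != x.
Proof.
move/familyP/(_ (enum_rank x)); rewrite unfold_in /parent /enters enum_rankK.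
case: (f _) => [e /eqP <- _|/eqP->]; first exact: loopless e.
by rewrite eqxx.
Qed.

Lemma choice_mxE (A : comNzRingType) f i j : f \in family enters ->
  choice_mx A f i j =
  (i == j)%:R - (enum_val i == parent f (enum_val j))%:R *+ (enum_val j != v).
Proof.
move/familyP/(_ j); rewrite unfold_in mxE /parent /enters enum_valK.
case: (f j) => [e /eqP <-|/eqP->]; first by rewrite tgt_neq_root.
by rewrite eqxx.
Qed.

Lemma det_choice_mx (A : idomainType) f : f \in family enters ->
  \det (choice_mx A f) = (acyclic f)%:R.
Proof.
move=> fE; case: (boolP (acyclic f)) => [/forallP acy|]; last first.
  case/forallPn=> x0 nx0; apply/eqP/det0P.
  (* The indicator of the vertices that never reach [v] is constant along parents and 0 at [v],
     hence a kernel vector. *)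
  pose z x : A := (~~ fconnect (parent f) x v)%:R.
  exists (\row_i z (enum_val i)).
    apply/negP=> /eqP/rowP/(_ (enum_rank x0)); rewrite !mxE enum_rankK /z nx0.
    by move/eqP; rewrite oner_eq0.
  apply/rowP=> j; rewrite mxE; under eq_bigr do rewrite mxE choice_mxE //.
  have [jv|jv] := eqVneq (enum_val j) v.
    under eq_bigr do rewrite mulr0n subr0.
    rewrite (bigD1 j) //= eqxx mulr1 big1 ?addr0; first by rewrite /z jv connect0 mxE.
    by move=> i /negPf ->; rewrite mulr0.
  under eq_bigr do rewrite mulr1n mulrBr -(inj_eq enum_val_inj).
  rewrite sumrB.
  rewrite (sum_enum_val (fun x => z x * (x == enum_val j)%:R)).
  rewrite (sum_enum_val (fun x => z x * (x == parent f (enum_val j))%:R)).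
  rewrite !sum_mul_delta mxE /z; apply/eqP; rewrite subr_eq0; apply/eqP.
  congr ((~~ _)%:R); apply/idP/idP => [|/(connect_trans (fconnect1 _ _))//].
  move/iter_findex; case: findex => [/= ej|n]; first by rewrite ej eqxx in jv.
  by rewrite iterSr => <-; apply: fconnect_iter.
rewrite -det_tr /determinant (bigD1 (1%g : 'S_#|G|)) //= odd_perm1 expr0 mul1r.
rewrite [X in _ + X]big1 ?addr0.
  apply: big1 => j _; rewrite perm1 mxE choice_mxE // eqxx.
  have [_|jv] := eqVneq (enum_val j) v; first by rewrite subr0.
  by rewrite eq_sym (negPf (parent_neq fE jv)) subr0.
(* A permutation with nonzero term sends each vertex to itself or its parent. By induction on the
   distance to [v] it fixes all: moving [j] to its already fixed parent would break injectivity. *)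
move=> s s1; apply/eqP; rewrite mulf_eq0; apply/orP; right; apply: contraNT s1.
move/prodf_neq0 => s_neq0; apply/eqP/permP=> j; rewrite perm1.
have s_or k : s k = k \/ enum_val k != v /\ enum_val (s k) = parent f (enum_val k).
  have := s_neq0 k isT; rewrite mxE choice_mxE //.
  have [->|_] := eqVneq (s k) k; first by left.
  have [_|kv] := eqVneq (enum_val k) v; first by rewrite subr0 eqxx.
  by case: (eqVneq (enum_val (s k))) => [|_]; [right | rewrite subr0 eqxx].
have /iter_findex := acy (enum_val j); move: (findex _ _ _) => n.
elim: n j => [|n IHn] j /=.
  by move=> jv; case: (s_or j) => // -[]; rewrite jv eqxx.
rewrite -iterS iterSr -[parent f _]enum_rankK => /IHn sp.
case: (s_or j) => // -[jv es]; have := parent_neq fE jv.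
have : s j = s (enum_rank (parent f (enum_val j))) by rewrite sp -es enum_valK.
by move/perm_inj=> {2}->; rewrite enum_rankK eqxx.
Qed.

Lemma prod_arcs (A : comNzRingType) (w : edge G -> A) f : f \in family enters ->
  \prod_j (if f j is Some e then w e else 1) = \prod_(e in arcs f) w e.
Proof.
move=> /familyP fE.
transitivity (\prod_j \prod_(e | f j == Some e) w e).
  apply: eq_bigr => j _; case: (f j) => [e|]; last by rewrite big_pred0.
  by rewrite (big_pred1 e) // => e'; rewrite /= eq_sym.
rewrite (exchange_big_dep predT) //= [RHS]big_mkcond; apply: eq_bigr => e _.
have fje j : f j == Some e -> j = enum_rank (tgt e).
  move/eqP=> fj; have := fE j; rewrite fj unfold_in => /eqP->.
  by rewrite enum_valK.
rewrite inE; case: ifPn => [fe|nfe]; last first.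
  by rewrite big_pred0 // => j; apply: contraNF nfe => fj; rewrite -(fje j).
by rewrite (big_pred1 (enum_rank (tgt e))) // => j; apply/idP/eqP => [/fje|->].
Qed.

Lemma arcs_inj : {in family enters &, injective arcs}.
Proof.
move=> f g /familyP fE /familyP gE /setP fg; apply/ffunP => j.
have sub f1 g1 e : f1 \in family enters -> arcs f1 =i arcs g1 ->
    f1 j = Some e -> g1 j = Some e.
  move=> /familyP/(_ j) + eq1 fj; rewrite fj unfold_in => /eqP te.
  have := eq1 e; rewrite !inE te enum_valK fj eqxx => /esym/eqP //.
have fE' : f \in family enters by apply/familyP.
have gE' : g \in family enters by apply/familyP.
case fj: (f j) => [e|]; first by rewrite (sub f g e).
by case gj: (g j) => [e|//]; rewrite -fj (sub g f e).
Qed.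

(** Iterated parents give a path from [v]. It is unique because paths can be compared from their
    last edges: one arc enters each vertex other than [v], and none enters [v]. *)
Lemma acyclic_arborescence f : f \in family enters -> acyclic f ->
  arborescence (arcs f).
Proof.
move=> fE /forallP acy; exists v => x.
have root_nil p e : dipath v (rcons p e) v = false.
  by rewrite dipath_rcons (negPf (tgt_neq_root e)) andbF.
have [p [px pA]] : exists p, dipath v p x /\ {subset p <= arcs f}.
  have /iter_findex := acy x; move: (findex _ _ _) => n.
  elim: n x => [|n IHn] x; first by move=> /= ->; exists [::] => /=; rewrite eqxx.
  rewrite iterSr => /IHn[p []]; rewrite /parent.
  case fx: (f _) => [e|] px pA; last by exists p.
  have /familyP/(_ (enum_rank x)) := fE; rewrite fx unfold_in enum_rankK => /eqP te.
  exists (rcons p e); rewrite dipath_rcons px te eqxx; split=> // e'.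
  by rewrite mem_rcons inE => /orP[/eqP->|/pA//]; rewrite inE te fx.
exists p; split=> // q [qx qA].
elim/last_ind: p x px pA q qx qA => [|p e IHp] x.
  move=> /eqP <- _ q; case/lastP: q => // q e; by rewrite root_nil.
rewrite dipath_rcons => /andP[pe /eqP te] pA q.
case/lastP: q => [/eqP xv _|q e'].
  by have := tgt_neq_root e; rewrite te -xv eqxx.
rewrite dipath_rcons => /andP[qe /eqP te'] qA.
have : Some e = Some e'.
  have := pA e; have := qA e'; rewrite !mem_rcons !inE !eqxx te te'.
  by move=> /(_ isT)/eqP <- /(_ isT)/eqP.
case=> ee; rewrite -ee in qe *; congr (rcons _ _).
apply: (IHp _ pe) => // e1 e1p; [apply: pA | apply: qA].
all: by rewrite mem_rcons inE e1p orbT.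
Qed.

(** The root must be [v], which no edge enters. Two edges of [A] with the same target would end two
    different paths from [v], so picking an entering edge recovers [A]. *)
Lemma arborescence_acyclic (A : {set edge G}) : arborescence A ->
  exists f, [/\ f \in family enters, acyclic f & arcs f = A].
Proof.
case=> r uniq_path.
have rv : r = v.
  have [p [[pv _] _]] := uniq_path v; case/lastP: p pv => [/eqP//|p e].
  by rewrite dipath_rcons (negPf (tgt_neq_root e)) andbF.
subst r.
have in_uniq e e' : e \in A -> e' \in A -> tgt e = tgt e' -> e = e'.
  move=> eA e'A ee'.
  have [p [[pe pA] _]] := uniq_path (src e).
  have [q [[qe qA] _]] := uniq_path (src e').
  have [r [_ r_uniq]] := uniq_path (tgt e).
  have r_p : r = rcons p e.
    apply: r_uniq; rewrite dipath_rcons pe eqxx; split=> // e1.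
    by rewrite mem_rcons inE => /orP[/eqP->|/pA].
  have r_q : r = rcons q e'.
    apply: r_uniq; rewrite dipath_rcons qe ee' eqxx; split=> // e1.
    by rewrite mem_rcons inE => /orP[/eqP->|/qA].
  by have := rcons_inj (etrans (esym r_p) r_q); case.
pose f := [ffun j : 'I_#|G| => [pick e in A | tgt e == enum_val j]].
have arcsE : arcs f = A.
  apply/setP=> e; rewrite inE ffunE enum_rankK.
  case: pickP => [e' /andP[e'A /eqP te']|none].
    by apply/eqP/idP => [[<-] //|eA]; congr Some; apply: in_uniq.
  by have := none e; rewrite eqxx andbT => ->.
have reach x p : dipath v p x -> {subset p <= A} -> fconnect (parent f) x v.
  elim/last_ind: p x => [|p e IHp] x; first by move=> /eqP ->; rewrite connect0.
  rewrite dipath_rcons => /andP[pe /eqP <-] pA.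
  have : e \in arcs f by rewrite arcsE pA // mem_rcons mem_head.
  rewrite inE => /eqP fe.
  have par_e : parent f (tgt e) = src e by rewrite /parent fe.
  apply: connect_trans (fconnect1 _ _) _; rewrite par_e.
  by apply: IHp => // e1 e1p; apply: pA; rewrite mem_rcons inE e1p orbT.
exists f; split=> //; last first.
  by apply/forallP=> x; have [p [[px pA] _]] := uniq_path x; apply: reach pA.
apply/familyP=> j; rewrite unfold_in ffunE.
case: pickP => [e /andP[_]//|none] /=.
have [p [[]]] := uniq_path (enum_val j); case/lastP: p => [/eqP->//|p e].
rewrite dipath_rcons => /andP[_ te] /(_ e); rewrite mem_rcons mem_head => /(_ isT) eA.
by have := none e; rewrite eA te.
Qed.

(** In the expansion over choices exactly the acyclic ones survive, with coefficient 1, and [arcs]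
    matches them with the arborescences. *)
Theorem kirchhoffE : kirchhoff G = tree_poly (@edge_var G).
Proof.
have arbE : arb G = [set arcs f | f in [pred f in family enters | acyclic f]].
  apply/setP=> A; rewrite inE; apply/asboolP/imsetP.
    by move=> /arborescence_acyclic[f [fE fA <-]]; exists f; rewrite // inE fE.
  by case=> f; rewrite inE => /andP[fE fA] ->; apply: acyclic_arborescence.
rewrite /kirchhoff arbE big_imset; last first.
  by move=> f g /andP[fE _] /andP[gE _]; apply: arcs_inj.
rewrite tree_poly_choices /= big_mkcondr /=; apply: eq_bigr => f fE.
by rewrite prod_arcs // det_choice_mx //; case: acyclic; rewrite ?mulr1 ?mulr0.
Qed.

End Laplacian.

Theorem theorem3p5 (G : digraph) (v : G) :
  rooted v ->
  strongly_connected (induced (~: [set v])) ->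
  (forall u : G, ~ nontrivial_dominator v u) ->
  prime_poly (kirchhoff G).
Proof.
move=> rooted_v strong_v dom_v P Q; rewrite (kirchhoffE rooted_v).
exact: (factors_trivial rooted_v strong_v dom_v).
Qed.
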